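(* For every finite simple graph $G$, $$\alpha_1(G) + \tau_B(G) \leq \frac{|V(G)|^2}{4}.$$ Moreover, equality holds if and only if $G$ is a join of a collection of complete balanced bipartite graphs.
   Context: All graphs are finite and simple. A set of edges $T \subseteq E(G)$ of a graph $G$ is triangle-independent if $T$ contains at most one edge from each triangle in $G$. $\alpha_1(G)$ denotes the maximum size of a triangle-independent set in $G$. $\tau_B(G)$ denotes the minimum size of a set $F \subseteq E(G)$ such that $G \setminus F$ (the graph obtained from $G$ by deleting the edges in $F$) is bipartite. The join $H_1 \vee H_2 \vee \cdots \vee H_k$ of a collection of vertex-disjoint graphs $H_1,\dots,H_k$ is the graph obtained from their union by joining, for all $i \neq j$, every vertex of $H_i$ to every vertex of $H_j$ by an edge (a single graph, $k=1$, is allowed; the graph with no vertices is regarded as the join of the empty collection). A complete balanced bipartite graph is a graph $K_{t,t}$ with $t \geq 1$. *)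

(* Defs.v *)
From HB Require Import structures.
From mathcomp Require Import all_boot all_order all_algebra.

Set Implicit Arguments.
Unset Strict Implicit.
Unset Printing Implicit Defensive.

Record sgraph := SGraph {
  vertex :> finType;
  adj : rel vertex;
  adj_sym : symmetric adj;
  adj_irr : irreflexive adj
}.

(* Edges are unordered pairs of adjacent vertices; since [adj] is irreflexive,
   every edge has exactly two elements. *)
Definition edges (G : sgraph) : {set {set G}} :=
  [set [set p.1; p.2] | p : G * G & adj p.1 p.2].

Definition triangle (G : sgraph) (x y z : G) : bool :=
  [&& adj x y, adj y z & adj x z].

Definition triangle_edges (G : sgraph) (x y z : G) : {set {set G}} :=
  [set [set x; y]; [set y; z]; [set x; z]].

Definition triangle_independent (G : sgraph) (T : {set {set G}}) : bool :=
  (T \subset edges G) &&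
  [forall x : G, forall y : G, forall z : G,
     triangle x y z ==> (#|T :&: triangle_edges x y z| <= 1)].

Definition alpha1 (G : sgraph) : nat :=
  \max_(T : {set {set G}} | triangle_independent T) #|T|.

Section DeleteEdges.
Variables (G : sgraph) (F : {set {set G}}).

Definition delete_adj : rel G :=
  fun x y => adj x y && ([set x; y] \notin F).

Fact delete_adj_sym : symmetric delete_adj.
Proof. by move=> x y; rewrite /delete_adj adj_sym setUC. Qed.

Fact delete_adj_irr : irreflexive delete_adj.
Proof. by move=> x; rewrite /delete_adj adj_irr. Qed.

Definition delete_edges : sgraph := SGraph delete_adj_sym delete_adj_irr.

End DeleteEdges.

Definition bipartite (G : sgraph) : bool :=
  [exists A : {set G}, forall x : G, forall y : G,
     adj x y ==> ((x \in A) != (y \in A))].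

Definition bipartizing (G : sgraph) (F : {set {set G}}) : bool :=
  (F \subset edges G) && bipartite (delete_edges F).

(* This makes the minimum in [tauB] range over a nonempty family. *)
Fact bipartizing_edges (G : sgraph) : bipartizing (edges G).
Proof.
rewrite /bipartizing subxx /=; apply/existsP; exists set0.
apply/forallP => x; apply/forallP => y; apply/implyP => /= /andP[xy /negP[]].
by apply/imsetP; exists (x, y); rewrite // inE.
Qed.

Definition tauB (G : sgraph) : nat :=
  #|[arg min_(F < edges G | bipartizing F) #|F|]|.

Section Join.
Variables (I : finType) (H : I -> sgraph).

(* [tagged_as u v] is [tagged v] transported to [H (tag u)] when the tags
   agree; vertices of distinct summands are always adjacent. *)
Definition join_adj : rel {i : I & H i} :=
  fun u v => (tag u == tag v) ==> adj (tagged u) (tagged_as u v).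

Fact join_adj_sym : symmetric join_adj.
Proof.
move=> [i x] [j y]; rewrite /join_adj /= [j == i]eq_sym.
by have [eq_ij|//] := eqVneq i j; case: j / eq_ij y => y; rewrite !tagged_asE /= adj_sym.
Qed.

Fact join_adj_irr : irreflexive join_adj.
Proof. by move=> [i x]; rewrite /join_adj eqxx tagged_asE adj_irr. Qed.

Definition join : sgraph := SGraph join_adj_sym join_adj_irr.

End Join.

Section CompleteBalancedBipartite.
Variable t : nat.

Definition Ktt_adj : rel ('I_t + 'I_t)%type :=
  fun u v => match u, v with
             | inl _, inr _ | inr _, inl _ => true
             | _, _ => false
             end.

Fact Ktt_adj_sym : symmetric Ktt_adj.
Proof. by move=> [x|x] [y|y]. Qed.

Fact Ktt_adj_irr : irreflexive Ktt_adj.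
Proof. by move=> [x|x]. Qed.

Definition Ktt : sgraph := SGraph Ktt_adj_sym Ktt_adj_irr.

End CompleteBalancedBipartite.

Definition isomorphic (G H : sgraph) : Prop :=
  exists2 f : G -> H, bijective f & {mono f : x y / adj x y}.

Definition join_of_balanced_bipartite (G : sgraph) : Prop :=
  exists (k : nat) (t : 'I_k -> nat),
    (forall i, 0 < t i) /\ isomorphic G (join (fun i => Ktt (t i))).

(* Main.v *)
Require Import Defs.
From mathcomp Require Import all_boot all_order all_algebra.
From mathcomp Require Import zify.
Import Order.TTheory GRing.Theory Num.Theory.

Set Implicit Arguments.
Unset Strict Implicit.
Unset Printing Implicit Defensive.

(** Let T be a triangle-independent set. For an edge uv of T, the T-neighbourhoods
    A of u and B of v are disjoint and independent in G. Put A and B on opposite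
    sides of a cut and cut the remaining vertices R by induction, choosing the
    better of the two orientations: at most half of the edges between A ∪ B and R
    stay uncut. The induction closes for uv if L(uv) <= R(uv), where
      L(uv) = 2 Σ_{x in A} d(x) + 2 Σ_{x in B} d(x) + 2 e_T(A ∪ B, R),
      R(uv) = (d(u) + d(v))^2 + 2 #(non-adjacent pairs between A ∪ B and R),
    and this holds on average over the edges of T. Indeed the degree terms sum to
    4 Σ d(u) d(v) <= Σ (d(u) + d(v))^2. The terms e_T(A ∪ B, R) count T-paths
    v-u-x-r with v, r not T-adjacent; writing Y(v, r) for the set of
    T-neighbours of v having a common T-neighbour with r, there are at most
    Σ |Y(v, r)| |Y(r, v)| of them, while the non-adjacent pairs contribute at
    least Σ |Y(v, r)|^2, since vertices with a common T-neighbour are not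
    adjacent.

    If the bound is attained, all these inequalities are equalities and every R
    is again extremal. Then T has no isolated vertex, T-adjacent vertices have
    equal T-degrees, T-paths with three edges have T-adjacent ends, and
    non-adjacent vertices have a common T-neighbour, so that the components of T
    are the parts of a join. Conversely, in such a join each vertex has as many
    non-neighbours (itself included) as T-neighbours, which bounds every cut. *)

(** * Termwise equality from equality of sums *)

Section SumEq.
Variables (I : finType) (f g : I -> nat).

Lemma eq_of_leq_sum :
  (forall i, f i <= g i) -> \sum_i g i <= \sum_i f i -> forall i, f i = g i.
Proof.
move=> le_fg le_gf i.
have le_rest : \sum_(j | j != i) f j <= \sum_(j | j != i) g j.
  by apply: leq_sum.
by move: le_gf (le_fg i); rewrite (bigD1 i) //= [in X in _ <= X](bigD1 i) //=; lia.
Qed.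

End SumEq.

(** * Counting pairs between vertex sets *)

Section Count.
Variable V : finType.
Implicit Types (e : rel V) (X Y S W A B R : {set V}).

(* Ordered pairs are counted: an edge inside X contributes 2 to [cnt e X X]. *)
Definition cnt e X Y := \sum_(x in X) \sum_(y in Y) (e x y : nat).

Lemma cnt_sym e X Y : symmetric e -> cnt e X Y = cnt e Y X.
Proof.
move=> e_sym; rewrite /cnt exchange_big /=.
by apply: eq_bigr => x _; apply: eq_bigr => y _; rewrite e_sym.
Qed.

Lemma cntUl e X X' Y :
  [disjoint X & X'] -> cnt e (X :|: X') Y = cnt e X Y + cnt e X' Y.
Proof. by move=> dXX'; rewrite /cnt -bigU //=; apply: eq_bigl => x; rewrite inE. Qed.

Lemma cntU2 e X Y : symmetric e -> [disjoint X & Y] ->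
  cnt e (X :|: Y) (X :|: Y) = cnt e X X + 2 * cnt e X Y + cnt e Y Y.
Proof.
move=> e_sym dXY; rewrite cntUl // (cnt_sym X) // (cnt_sym Y) // !cntUl //.
by rewrite (cnt_sym Y) //; lia.
Qed.

Lemma cntC e X Y : cnt e X Y + cnt (fun x y => ~~ e x y) X Y = #|X| * #|Y|.
Proof.
rewrite /cnt -big_split /= -sum_nat_const; apply: eq_bigr => x _.
rewrite -big_split /= -sum1_card; apply: eq_bigr => y _.
by case: (e x y).
Qed.

Lemma cnt_gt0 e X Y x y : x \in X -> y \in Y -> e x y -> 0 < cnt e X Y.
Proof. by move=> xX yY exy; rewrite /cnt (bigD1 x) //= (bigD1 y) //= exy. Qed.

Lemma cnt_all e X Y : cnt e X Y = \sum_x \sum_y ((x \in X) * (y \in Y) * e x y).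
Proof.
rewrite /cnt big_mkcond /=; apply: eq_bigr => x _.
case: (x \in X); last by rewrite big1.
by rewrite big_mkcond /=; apply: eq_bigr => y _; case: (y \in Y); rewrite ?mul1n.
Qed.

Lemma cnt_setT e : cnt e setT setT = \sum_x \sum_y (e x y : nat).
Proof.
rewrite cnt_all; apply: eq_bigr => x _; apply: eq_bigr => y _.
by rewrite !inE !mul1n.
Qed.

End Count.

(** * Uncut edges and the extension of a cut *)

Definition uncut (V : finType) (adj : rel V) (S : {set V}) : rel V :=
  fun x y => adj x y && ((x \in S) == (y \in S)).

Lemma uncut_sym (V : finType) (adj : rel V) (S : {set V}) :
  symmetric adj -> symmetric (uncut adj S).
Proof. by move=> adj_sym x y; rewrite /uncut adj_sym eq_sym. Qed.

(* Of the two ways to place A and B on opposite sides of a given cut of R, one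
   leaves at most half of the edges between A :|: B and R uncut. *)
Lemma cut_extend (V : finType) (adj : rel V) (A B R S : {set V}) :
  symmetric adj -> [disjoint A & B] -> [disjoint A :|: B & R] ->
  {in A &, forall x y, ~~ adj x y} -> {in B &, forall x y, ~~ adj x y} ->
  exists S', let W := (A :|: B) :|: R in
    cnt (uncut adj S') W W <= cnt (uncut adj S) R R + cnt adj (A :|: B) R.
Proof.
move=> adj_sym dAB dABR indA indB.
pose S1 := A :|: (S :&: R); pose S2 := B :|: (S :&: R).
have nAR x : x \in A -> (x \in R = false) * (x \in B = false).
  move=> xA; split; last by rewrite (disjointFr dAB xA).
  by rewrite (disjointFr dABR) // inE xA.
have nBR x : x \in B -> (x \in R = false) * (x \in A = false).
  move=> xB; split; last by rewrite (disjointFl dAB xB).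
  by rewrite (disjointFr dABR) // inE xB orbT.
have nR x : x \in R -> (x \in A = false) * (x \in B = false).
  move=> xR; have := disjointFl dABR xR; rewrite inE => /negbT.
  by rewrite negb_or => /andP[/negbTE-> /negbTE->].
have z1 : cnt (uncut adj S1) (A :|: B) (A :|: B) = 0.
  rewrite /cnt big1 // => x xAB; rewrite big1 // => y yAB.
  move: xAB yAB; rewrite /uncut !inE.
  case/orP=> hx; case/orP=> hy;
    rewrite ?(negbTE (indA _ _ hx hy)) ?(negbTE (indB _ _ hx hy)) //=.
    by rewrite hx !(nBR _ hy) andbF /= andbF.
  by rewrite hy !(nBR _ hx) andbF /= andbF.
have z2 : cnt (uncut adj S2) (A :|: B) (A :|: B) = 0.
  rewrite /cnt big1 // => x xAB; rewrite big1 // => y yAB.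
  move: xAB yAB; rewrite /uncut !inE.
  case/orP=> hx; case/orP=> hy;
    rewrite ?(negbTE (indA _ _ hx hy)) ?(negbTE (indB _ _ hx hy)) //=.
    by rewrite hy !(nAR _ hx) andbF /= andbF.
  by rewrite hx !(nAR _ hy) andbF /= andbF.
have zR S' : S' = S1 \/ S' = S2 -> cnt (uncut adj S') R R = cnt (uncut adj S) R R.
  move=> defS'; apply: eq_bigr => x xR; apply: eq_bigr => y yR.
  by rewrite /uncut; case: defS' => ->; rewrite !inE xR yR !(nR _ xR) !(nR _ yR) /= !andbT.
(* [S1] and [S2] agree on [R] and differ on all of [A :|: B], so each edge between these sets is
   uncut for exactly one of them. *)
have zABR : cnt (uncut adj S1) (A :|: B) R + cnt (uncut adj S2) (A :|: B) R
            = cnt adj (A :|: B) R.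
  rewrite /cnt -big_split /=; apply: eq_bigr => x; rewrite inE => xAB.
  rewrite -big_split /=; apply: eq_bigr => y yR; rewrite /uncut !inE yR !(nR _ yR) /=.
  case/orP: xAB => hx; rewrite hx.
    by rewrite !(nAR _ hx) andbF /=; case: (adj x y); case: (y \in S).
  by rewrite !(nBR _ hx) andbF /=; case: (adj x y); case: (y \in S).
have e1 := cntU2 (uncut_sym S1 adj_sym) dABR.
have e2 := cntU2 (uncut_sym S2 adj_sym) dABR.
rewrite z1 zR in e1; last by left.
rewrite z2 zR in e2; last by right.
(* Twice the smaller of the two counts, as it enters through [cntU2], is at most their sum. *)
case: (leqP (cnt (uncut adj S1) (A :|: B) R) (cnt (uncut adj S2) (A :|: B) R)) => h.
  by exists S1; rewrite /= e1; lia.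
by exists S2; rewrite /= e2; lia.
Qed.

(** * Paths and joined pairs in a triangle-free relation *)

Section TriangleFree.
Variables (V : finType) (t : rel V).
Hypothesis t_sym : symmetric t.
Hypothesis t_free : forall x y z, t x y -> t x z -> ~~ t y z.

Definition deg x := \sum_y (t x y : nat).
Definition joined x y := [exists z, t x z && t z y].

Lemma joinedP x y z : t x z -> t z y -> joined x y.
Proof. by move=> txz tzy; apply/existsP; exists z; rewrite txz. Qed.

Lemma joined_nadj x y : joined x y -> ~~ t x y.
Proof.
by case/existsP=> z /andP[txz tzy]; apply: (t_free (x := z)) => //; rewrite t_sym.
Qed.

(* |Y(x, y)| in the notation of the header. *)
Definition reach x y := \sum_u (t x u * joined u y).
(** For an edge uv, [paths u v] counts the edges from A to R; the absence of triangles keeps [r]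
    outside A, so only [v] is tested. [gaps u v] counts the pairs between A and R that have a common
    neighbour. *)
Definition paths u v := \sum_x \sum_r (t u x * t x r * ~~ t v r).
Definition gaps u v := \sum_x \sum_r (t u x * joined x r * (~~ t u r * ~~ t v r)).

(** Each inner sum depends on one end of the edge only, so summing over the other end contributes
    the degree as a factor. *)
Lemma sum_deg_nbr :
  \sum_u \sum_v (t u v * (\sum_x (t u x * deg x) + \sum_x (t v x * deg x)))
  = \sum_u \sum_v (t u v * (2 * (deg u * deg v))).
Proof.
have half : \sum_u \sum_v (t u v * \sum_x (t u x * deg x)) =
            \sum_u \sum_v (t u v * (deg u * deg v)).
  apply: eq_bigr => u _; rewrite -big_distrl /= -/(deg u) big_distrr /=.
  by apply: eq_bigr => v _; rewrite mulnCA.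
under eq_bigr => u _ do under eq_bigr => v _ do rewrite mulnDr.
under eq_bigr => u _ do rewrite big_split.
rewrite big_split /= half [X in _ + X]exchange_big /=.
under [X in _ + X]eq_bigr => u _ do under eq_bigr => v _ do rewrite t_sym.
rewrite half -big_split /=; apply: eq_bigr => u _.
by rewrite -big_split /=; apply: eq_bigr => v _; lia.
Qed.

Lemma sum_edges_sym (F : V -> V -> nat) :
  \sum_u \sum_v (t u v * (F u v + F v u)) = 2 * \sum_u \sum_v (t u v * F u v).
Proof.
under eq_bigr => u _ do under eq_bigr => v _ do rewrite mulnDr.
under eq_bigr => u _ do rewrite big_split.
rewrite big_split /= [X in _ + X]exchange_big /=.
under [X in _ + X]eq_bigr => u _ do under eq_bigr => v _ do rewrite t_sym.
by rewrite mul2n addnn.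
Qed.

(** All counts are written over the same quadruples, so that equality of totals becomes equality at
    each quadruple. In the primed weights [u] ranges over Y(v, r), and [x] over Y(r, v) or Y(v, r)
    respectively. *)
Definition pathw v r u x : nat := ~~ t v r * (t v u * t u x * t x r).
Definition pathw' v r u x : nat :=
  ~~ t v r * ((t v u * joined u r) * (t r x * joined x v)).
Definition gapw' v r u x : nat :=
  ~~ t v r * ((t v u * joined u r) * (t v x * joined x r)).
Definition gapw v r u x : nat :=
  ~~ t v r * ((t v u * ~~ t u r) * (t v x * joined x r)).

Definition sum4 (F : V -> V -> V -> V -> nat) := \sum_v \sum_r \sum_u \sum_x F v r u x.

Lemma leq_sum4 F G : (forall v r u x, F v r u x <= G v r u x) -> sum4 F <= sum4 G.
Proof. by move=> le_FG; do 4!apply: leq_sum => ? _. Qed.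

Lemma eq_of_leq_sum4 F G : (forall v r u x, F v r u x <= G v r u x) ->
  sum4 G <= sum4 F -> forall v r u x, F v r u x = G v r u x.
Proof.
move=> le_FG le_GF v r u x.
apply: (eq_of_leq_sum (f := F v r u)) => [//|].
rewrite (eq_of_leq_sum (f := fun u => \sum_x F v r u x)
  (g := fun u => \sum_x G v r u x)) => [//|i|]; first exact: leq_sum.
rewrite (eq_of_leq_sum (f := fun r => \sum_u \sum_x F v r u x)
  (g := fun r => \sum_u \sum_x G v r u x)) => [//|i|].
  by do 2!apply: leq_sum => ? _.
rewrite (eq_of_leq_sum (f := fun v => \sum_r \sum_u \sum_x F v r u x)
  (g := fun v => \sum_r \sum_u \sum_x G v r u x)) => [//|i|//].
by do 3!apply: leq_sum => ? _.
Qed.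

Lemma pathsE : \sum_u \sum_v (t u v * paths u v) = sum4 pathw.
Proof.
rewrite exchange_big /=; apply: eq_bigr => v _.
rewrite [RHS]exchange_big /=; apply: eq_bigr => u _.
rewrite /paths big_distrr /= [RHS]exchange_big /=; apply: eq_bigr => x _.
rewrite big_distrr /=; apply: eq_bigr => r _; rewrite /pathw (t_sym u v).
by case: (t v u); case: (t u x); case: (t x r); case: (t v r).
Qed.

Lemma gapsE : \sum_u \sum_v (t u v * gaps u v) = sum4 gapw.
Proof.
apply: eq_bigr => u _; rewrite [RHS]exchange_big /=; apply: eq_bigr => v _.
rewrite /gaps big_distrr /= [RHS]exchange_big /=; apply: eq_bigr => x _.
rewrite big_distrr /=; apply: eq_bigr => r _; rewrite /gapw.
by case: (t u v); case: (t u x); case: (joined x r); case: (t v r); case: (t u r).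
Qed.

(** On a path v-u-x-r, [x] joins [u] to [r] and [u] joins [x] to [v]. *)
Lemma leq_pathw v r u x : pathw v r u x <= pathw' v r u x.
Proof.
rewrite /pathw /pathw' leq_mul2l; apply/orP; right.
case tvu: (t v u) => //; case tux: (t u x) => //; case txr: (t x r) => //.
by rewrite (joinedP tux txr) t_sym txr (@joinedP x v u) // t_sym.
Qed.

Lemma leq_gapw v r u x : gapw' v r u x <= gapw v r u x.
Proof.
rewrite /gapw /gapw' leq_mul2l; apply/orP; right; rewrite leq_mul2r; apply/orP; right.
rewrite leq_mul2l; apply/orP; right.
by case jur: (joined u r) => //; rewrite joined_nadj.
Qed.

Lemma sum_pathw' : sum4 pathw' = \sum_v \sum_r (~~ t v r * (reach v r * reach r v)).
Proof.
apply: eq_bigr => v _; apply: eq_bigr => r _.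
rewrite /reach big_distrl /= big_distrr /=; apply: eq_bigr => u _.
by rewrite big_distrr /= big_distrr.
Qed.

Lemma sum_gapw' : sum4 gapw' = \sum_v \sum_r (~~ t v r * (reach v r * reach v r)).
Proof.
apply: eq_bigr => v _; apply: eq_bigr => r _.
rewrite /reach big_distrl /= big_distrr /=; apply: eq_bigr => u _.
by rewrite big_distrr /= big_distrr.
Qed.

(** After symmetrising in [v] and [r] this is 2ab <= a^2 + b^2 with a = |Y(v, r)| and b = |Y(r,
    v)|. *)
Lemma leq_pathw'_gapw' : sum4 pathw' <= sum4 gapw'.
Proof.
rewrite -(leq_pmul2l (isT : 0 < 2)) !mul2n -!addnn sum_gapw'.
rewrite [X in _ <= _ + X]exchange_big sum_pathw' -!big_split /=.
apply: leq_sum => v _; rewrite -!big_split /=; apply: leq_sum => r _.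
rewrite (t_sym r v); case: (t v r) => //; rewrite !mul1n.
by case: (nat_Cauchy (reach v r) (reach r v)); rewrite -!mulnn; lia.
Qed.

Lemma leq_paths_gaps :
  \sum_u \sum_v (t u v * paths u v) <= \sum_u \sum_v (t u v * gaps u v).
Proof.
rewrite pathsE gapsE; apply: leq_trans (leq_sum4 leq_gapw).
exact: leq_trans (leq_sum4 leq_pathw) leq_pathw'_gapw'.
Qed.

(** Equality in [leq_gapw] forces [r'] to be joined to [v], hence to lie in Y(r, v). As [u] lies in
    Y(v, r), equality in [leq_pathw] makes v-u-r'-r a path. *)
Lemma paths_gaps_eq v u x r r' :
  \sum_u \sum_v (t u v * gaps u v) <= \sum_u \sum_v (t u v * paths u v) ->
  t v u -> t u x -> t x r -> t r r' -> ~~ t v r -> ~~ t v r' -> t u r'.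
Proof.
rewrite pathsE gapsE => le_gp tvu tux txr trr' nvr nvr'.
have leA := leq_sum4 leq_pathw; have leB := leq_sum4 leq_gapw.
have leC := leq_pathw'_gapw'.
have eq_p := eq_of_leq_sum4 leq_pathw; have eq_g := eq_of_leq_sum4 leq_gapw.
have {}eq_p : pathw v r u r' = pathw' v r u r' by apply: eq_p; lia.
have {}eq_g : gapw' r v r' x = gapw r v r' x by apply: eq_g; lia.
have trx : t r x by rewrite t_sym.
have jxv : joined x v by apply: (@joinedP x v u); rewrite t_sym.
have jur := joinedP tux txr.
move: eq_g; rewrite /gapw /gapw' trr' trx jxv (t_sym r v) nvr (t_sym r' v) nvr' /=.
case jr'v: (joined r' v) => // _.
by move: eq_p; rewrite /pathw /pathw' nvr tvu jur trr' jr'v; case: (t u r').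
Qed.

End TriangleFree.

(** * Building a cut by induction *)

Section Tightness.
Variables (V : finType) (adj T : rel V).
Hypothesis adj_sym : symmetric adj.
Hypothesis adj_irr : irreflexive adj.
Hypothesis T_sym : symmetric T.
Hypothesis T_adj : forall x y, T x y -> adj x y.
Hypothesis T_ind : forall x y z, T x y -> T x z -> ~~ adj y z.
Implicit Types (W S : {set V}) (u v x y : V).

(** The induction runs over subsets of one fixed vertex set; [res W] is [T] on the subgraph induced
    by [W]. *)
Definition res W : rel V := fun x y => [&& x \in W, y \in W & T x y].
Definition nbr W u := [set x | res W u x].
Definition rest W u v := W :\: (nbr W u :|: nbr W v).
Definition nadj : rel V := fun x y => ~~ adj x y.

Lemma res_sym W : symmetric (res W).
Proof. by move=> x y; rewrite /res T_sym andbCA. Qed.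

Lemma res_nadj W x y z : res W x y -> res W x z -> ~~ adj y z.
Proof. by case/and3P=> _ _ Txy /and3P[_ _]; apply: T_ind. Qed.

Lemma res_free W x y z : res W x y -> res W x z -> ~~ res W y z.
Proof.
move=> xy xz; apply: contra (res_nadj xy xz) => /and3P[_ _]; exact: T_adj.
Qed.

Lemma joined_res_nadj W x y : joined (res W) x y -> ~~ adj x y.
Proof.
by case/existsP=> z /andP[xz zy]; rewrite res_sym in xz; apply: res_nadj xz zy.
Qed.

(* L(uv) and R(uv) of the header, for the subgraph induced by W. *)
Definition lhs W u v : nat :=
  2 * (\sum_x (res W u x * deg (res W) x) + \sum_x (res W v x * deg (res W) x)) +
  2 * (paths (res W) u v + paths (res W) v u).

Definition rhs W u v : nat :=
  (deg (res W) u + deg (res W) v) ^ 2 +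
  2 * cnt nadj (nbr W u :|: nbr W v) (rest W u v).

Section Edge.
Variables (W : {set V}) (u v : V).
Hypothesis uv : res W u v.

Let AB := nbr W u :|: nbr W v.
Let R := rest W u v.

Lemma nbr_disjoint : [disjoint nbr W u & nbr W v].
Proof.
rewrite -setI_eq0; apply/eqP/setP => x; rewrite !inE; apply/negbTE/negP.
case/andP=> ux vx; have := res_free uv ux; by rewrite vx.
Qed.

Lemma card_nbr w : #|nbr W w| = deg (res W) w.
Proof.
rewrite -sum1_card big_mkcond /=; apply: eq_bigr => x _.
by rewrite inE; case: (res W w x).
Qed.

Lemma nbr_sub w : nbr W w \subset W.
Proof. by apply/subsetP => x; rewrite inE => /and3P[]. Qed.

Lemma nbrs_rest : AB :|: R = W.
Proof.
rewrite /R /rest setDE setUIr setUCr setIT; apply/setUidPr.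
by rewrite subUset !nbr_sub.
Qed.

Lemma nbrs_rest_disjoint : [disjoint AB & R].
Proof. by rewrite -setI_eq0 /R /rest setDE setICA setICr setI0. Qed.

Lemma cnt_nbr w : cnt T (nbr W w) W = \sum_x (res W w x * deg (res W) x).
Proof.
rewrite /cnt big_mkcond /=; apply: eq_bigr => x _; rewrite inE.
case wx: (res W w x) => //; rewrite mul1n big_mkcond /=; apply: eq_bigr => y _.
by case/and3P: wx => _ xW _; rewrite /res xW; case: (y \in W).
Qed.

Lemma pathsP w w' : res W w w' ->
  cnt T (nbr W w) (rest W w w') = paths (res W) w w'.
Proof.
move=> ww'; rewrite cnt_all; apply: eq_bigr => x _; apply: eq_bigr => r _.
rewrite !inE; case wx: (res W w x) => //; rewrite !mul1n.
case xr: (res W x r); last first.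
  case/and3P: wx => _ xW _; move: xr; rewrite /res xW /=.
  by case: (r \in W); rewrite ?andbF //= => ->; rewrite muln0.
(* Absence of triangles puts [r] outside [nbr W w], so only [w'] decides whether it lies in the
   rest. *)
have wr : res W w r = false.
  by rewrite res_sym in wx; apply/negbTE/(res_free wx xr).
by case/and3P: (xr) => _ rW Txr; rewrite wr rW Txr andbT muln1 mul1n.
Qed.

Lemma gapsP w w' : gaps (res W) w w' <= cnt nadj (nbr W w) (rest W w w').
Proof.
rewrite cnt_all; apply: leq_sum => x _; apply: leq_sum => r _.
rewrite !inE; case wx: (res W w x) => //; rewrite !mul1n.
case jxr: (joined (res W) x r) => //; rewrite mul1n.
have rW : r \in W by case/existsP: jxr => z /andP[_ /and3P[]].
by rewrite rW /nadj (joined_res_nadj jxr); case: (res W w r); case: (res W w' r).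
Qed.

End Edge.

Lemma rest_sym W u v : rest W u v = rest W v u.
Proof. by rewrite /rest setUC. Qed.

Lemma card_rest W u v : res W u v -> #|rest W u v| < #|W|.
Proof.
move=> uv; apply: proper_card; rewrite properE subsetDl /=.
apply/subsetPn; exists u; first by case/and3P: uv.
by rewrite !inE (res_sym W v) uv orbT.
Qed.

(** The difference |W|^2 - |R|^2 exceeds [rhs] by twice the number of edges between A ∪ B and R,
    which pays for those left uncut by [cut_extend]; [lhs] is exactly the growth of [2 * cnt T]. The
    additive form serves both the bound and the transfer of tightness. *)
Lemma cut_step W u v S : res W u v ->
  let R := rest W u v in
  exists S', 2 * cnt (uncut adj S') W W + 2 * cnt T W W + (#|R| ^ 2 + rhs W u v)
    <= #|W| ^ 2 + (2 * cnt (uncut adj S) R R + 2 * cnt T R R + lhs W u v).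
Proof.
move=> uv R; pose AB := nbr W u :|: nbr W v.
have dAB := nbr_disjoint uv.
have dABR : [disjoint AB & R] by apply: nbrs_rest_disjoint.
have defW : AB :|: R = W by apply: nbrs_rest.
have indep w : {in nbr W w &, forall x y, ~~ adj x y}.
  by move=> x y; rewrite !inE; apply: res_nadj.
have [S' /=] := cut_extend S adj_sym dAB dABR (@indep u) (@indep v).
rewrite defW => leS'; exists S'.
have eT := cntU2 T_sym dABR; rewrite defW in eT.
have eABR : cnt T AB R = paths (res W) u v + paths (res W) v u.
  rewrite /AB cntUl // pathsP // /R rest_sym pathsP //; by rewrite res_sym.
have eABW : cnt T AB AB + cnt T AB R =
    \sum_x (res W u x * deg (res W) x) + \sum_x (res W v x * deg (res W) x).
  rewrite -!cnt_nbr -cntUl // -/AB -[in RHS]defW [RHS]cnt_sym // cntUl //.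
  by rewrite (cnt_sym R).
have cAB : #|AB| = deg (res W) u + deg (res W) v.
  rewrite -!card_nbr cardsU (_ : _ :&: _ = set0) ?cards0 ?subn0 //.
  by apply/eqP; rewrite setI_eq0.
have cW : #|W| = #|AB| + #|R|.
  rewrite -defW cardsU (_ : _ :&: _ = set0) ?cards0 ?subn0 //.
  by apply/eqP; rewrite setI_eq0.
have eC := cntC adj AB R.
rewrite /lhs /rhs -eABR -eABW -/AB -/R -cAB cW eT -!mulnn.
rewrite -/nadj in eC; move: leS' eC; rewrite -/AB; nia.
Qed.

Lemma leq_sum_deg W :
  4 * (\sum_u \sum_v (res W u v * (deg (res W) u * deg (res W) v))) <=
  \sum_u \sum_v (res W u v * (deg (res W) u + deg (res W) v) ^ 2).
Proof.
rewrite big_distrr /=; apply: leq_sum => u _; rewrite big_distrr /=.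
apply: leq_sum => v _; rewrite mulnCA leq_mul2l; apply/orP; right.
by have [+ _] := nat_AGM2 (deg (res W) u) (deg (res W) v); lia.
Qed.

Lemma sum_lhsE W : \sum_u \sum_v (res W u v * lhs W u v) =
  4 * (\sum_u \sum_v (res W u v * (deg (res W) u * deg (res W) v))) +
  4 * (\sum_u \sum_v (res W u v * paths (res W) u v)).
Proof.
transitivity
  (2 * (\sum_u \sum_v (res W u v * (2 * (deg (res W) u * deg (res W) v)))) +
   2 * (2 * \sum_u \sum_v (res W u v * paths (res W) u v))).
  rewrite -(sum_deg_nbr (@res_sym W)) -(sum_edges_sym (@res_sym W) (paths _)).
  under eq_bigr => u _ do under eq_bigr => v _ do
    rewrite /lhs mulnDr (mulnCA _ 2 (_ + _)) (mulnCA _ 2 (paths _ _ _ + _)).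
  by under eq_bigr => u _ do rewrite big_split -!big_distrr; rewrite big_split -!big_distrr.
congr (_ + _); last by rewrite mulnA.
rewrite (_ : 4 = 2 * 2) // -mulnA; congr (2 * _).
rewrite big_distrr; apply: eq_bigr => u _; rewrite big_distrr.
by apply: eq_bigr => v _; rewrite mulnCA.
Qed.

Lemma leq_sum_rhs W :
  \sum_u \sum_v (res W u v * (deg (res W) u + deg (res W) v) ^ 2) +
  4 * (\sum_u \sum_v (res W u v * gaps (res W) u v)) <=
  \sum_u \sum_v (res W u v * rhs W u v).
Proof.
rewrite (_ : 4 = 2 * 2) // -mulnA -(sum_edges_sym (@res_sym W)).
rewrite big_distrr -big_split; apply: leq_sum => u _.
rewrite big_distrr -big_split; apply: leq_sum => v _ /=.
case uv: (res W u v) => //; rewrite !mul1n /rhs leq_add2l leq_mul2l /=.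
rewrite cntUl ?nbr_disjoint //; apply: leq_add; first exact: gapsP.
by rewrite rest_sym; apply: gapsP.
Qed.

(** The averaging argument: the degree terms and the path terms are compared separately. *)
Lemma leq_sum_lhs_rhs W :
  \sum_u \sum_v (res W u v * lhs W u v) <= \sum_u \sum_v (res W u v * rhs W u v).
Proof.
rewrite sum_lhsE; apply: leq_trans (leq_sum_rhs W).
apply: leq_add; first exact: leq_sum_deg.
by rewrite leq_mul2l /=; apply: leq_paths_gaps; [apply: res_sym|apply: res_free].
Qed.

(** Without [T]-edges a single vertex is split off, with A = {w} and B empty. The square drops by
    2(|W| - 1) + 1, more than twice the degree of [w]; the strictness later shows that a nonempty
    tight set contains a [T]-edge. *)
Lemma cut_step_empty W w S : w \in W -> (forall x y, ~~ res W x y) ->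
  exists S', 2 * cnt (uncut adj S') W W + 2 * cnt T W W + #|W :\ w| ^ 2
    < #|W| ^ 2 + (2 * cnt (uncut adj S) (W :\ w) (W :\ w)
                  + 2 * cnt T (W :\ w) (W :\ w)).
Proof.
move=> wW T0.
have d0 : [disjoint [set w] & set0] by rewrite -setI_eq0 setI0.
have dR : [disjoint [set w] :|: set0 & W :\ w].
  by rewrite setU0 disjoints1 !inE eqxx.
have ind1 : {in [set w] &, forall x y, ~~ adj x y}.
  by move=> x y /set1P-> /set1P->; rewrite adj_irr.
have ind0 : {in set0 &, forall x y, ~~ adj x y} by move=> x y; rewrite inE.
have [S' /=] := cut_extend S adj_sym d0 dR ind1 ind0.
rewrite setU0 setD1K // => leS'; exists S'.
have -> : cnt T W W = 0.
  rewrite /cnt big1 // => x xW; rewrite big1 // => y yW.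
  by have := T0 x y; rewrite /res xW yW /= => /negbTE->.
have := cntC adj [set w] (W :\ w); rewrite cards1 => eC.
by have := cardsD1 w W; rewrite wW -!mulnn; nia.
Qed.

Lemma sum_lhs_rhs_eq W : (forall u v, res W u v -> rhs W u v <= lhs W u v) ->
  \sum_u \sum_v (res W u v * rhs W u v) <= \sum_u \sum_v (res W u v * lhs W u v)
  /\ forall u v, res W u v -> rhs W u v = lhs W u v.
Proof.
move=> le_rl.
have le1 u v : res W u v * rhs W u v <= res W u v * lhs W u v.
  by case uv: (res W u v) => //; rewrite !mul1n le_rl.
have le2 u : \sum_v (res W u v * rhs W u v) <= \sum_v (res W u v * lhs W u v).
  exact: leq_sum.
split=> [|u v uv]; first exact: leq_sum.
have eq_u := eq_of_leq_sum le2 (leq_sum_lhs_rhs W) u.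
have := eq_of_leq_sum (le1 u) _ v; rewrite eq_u leqnn uv !mul1n; exact.
Qed.

Lemma cut_bound W : exists S, 2 * cnt (uncut adj S) W W + 2 * cnt T W W <= #|W| ^ 2.
Proof.
have [n] := ubnP #|W|; elim: n W => // n IHn W; rewrite ltnS => leWn.
case: (boolP [forall x, forall y, ~~ res W x y]) => [T0|].
  have {}T0 x y : ~~ res W x y by have /forallP/(_ x)/forallP/(_ y) := T0.
  case: (set_0Vmem W) => [->|[w wW]].
    by exists set0; rewrite /cnt !big_set0.
  have [|S leS] := IHn (W :\ w).
    by move: leWn; rewrite (cardsD1 w W) wW; lia.
  by have [S' leS'] := cut_step_empty S wW T0; exists S'; lia.
move=> notT0.
have [u [v [uv leuv]]] : exists u v, res W u v /\ lhs W u v <= rhs W u v.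
  case: (boolP [exists u, exists v, res W u v && (lhs W u v <= rhs W u v)]).
    by case/existsP=> u /existsP[v /andP[uv le_lr]]; exists u, v.
  (* If no edge qualified, averaging would turn the strict inequalities into equalities, although
     [W] contains an edge. *)
  move=> noE; have lt_rl u v : res W u v -> rhs W u v < lhs W u v.
    move=> uv; rewrite ltnNge; apply: contra noE => le_lr.
    by apply/existsP; exists u; apply/existsP; exists v; rewrite uv.
  case/forallPn: notT0 => u /forallPn[v]; rewrite negbK => uv.
  have [_ /(_ u v uv) eq_rl] := sum_lhs_rhs_eq (fun u v uv => ltnW (lt_rl u v uv)).
  by have := lt_rl u v uv; rewrite eq_rl ltnn.
have [|S leS] := IHn (rest W u v).
  by apply: leq_trans leWn; apply: card_rest.
by have [S' leS'] := cut_step S uv; exists S'; lia.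
Qed.

(** * Vertex sets attaining the bound *)

Definition tight W :=
  forall S, #|W| ^ 2 <= 2 * cnt (uncut adj S) W W + 2 * cnt T W W.

(** If L(uv) < R(uv), extending a cut of the rest given by [cut_bound] would beat the bound on [W].
    Averaging then makes every edge an equality, and [cut_step] passes tightness to the rest. *)
Lemma tight_edge W : tight W ->
  (forall u v, res W u v -> tight (rest W u v) /\ rhs W u v = lhs W u v) /\
  \sum_u \sum_v (res W u v * rhs W u v) <= \sum_u \sum_v (res W u v * lhs W u v).
Proof.
move=> tightW.
have le_rl u v : res W u v -> rhs W u v <= lhs W u v.
  move=> uv; have [S leS] := cut_bound (rest W u v).
  by have [S' leS'] := cut_step S uv; have := tightW S'; lia.
have [le_sum eq_rl] := sum_lhs_rhs_eq le_rl; split=> // u v uv; split; last exact: eq_rl.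
move=> S; have [S' leS'] := cut_step S uv; have := tightW S'.
by have := eq_rl _ _ uv; lia.
Qed.

(** For any [T]-edge uv, either [x] is a neighbour of [u] or [v], or it lies in the smaller tight
    set [rest W u v]. *)
Lemma tight_no_isolated W x : tight W -> x \in W -> exists y, res W x y.
Proof.
have [n] := ubnP #|W|; elim: n W => // n IHn W; rewrite ltnS => leWn tightW xW.
case: (boolP [forall x, forall y, ~~ res W x y]) => [T0|].
  have {}T0 u v : ~~ res W u v by have /forallP/(_ u)/forallP/(_ v) := T0.
  have [S leS] := cut_bound (W :\ x).
  have [S' leS'] := cut_step_empty S xW T0.
  by have := tightW S'; lia.
case/forallPn => u /forallPn[v]; rewrite negbK => uv.
have [/(_ u v uv)[tightR _] _] := tight_edge tightW.
case xR: (x \in rest W u v).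
  have [|y /and3P[_ yR Txy]] := IHn _ (leq_trans (card_rest uv) leWn) tightR _ => //.
  by exists y; rewrite /res xW Txy; move: yR; rewrite inE => /andP[_ ->].
move: xR; rewrite !inE xW andbT => /negbFE/orP[ux|vx]; [exists u|exists v];
  by rewrite res_sym.
Qed.

(** Both halves of the averaged inequality must be sharp; equality in AM-GM at each edge gives equal
    degrees. *)
Lemma tight_deg_paths W : tight W ->
  (forall u v, res W u v -> deg (res W) u = deg (res W) v) /\
  \sum_u \sum_v (res W u v * gaps (res W) u v) <=
  \sum_u \sum_v (res W u v * paths (res W) u v).
Proof.
move=> tightW; have [_ le_sum] := tight_edge tightW.
have le1 := leq_sum_rhs W; rewrite sum_lhsE in le_sum.
have le2 := leq_sum_deg W.
have le3 := leq_paths_gaps (@res_sym W) (@res_free W).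
split=> [u v uv|]; last by lia.
pose f u v := res W u v * (4 * (deg (res W) u * deg (res W) v)).
pose g u v := res W u v * (deg (res W) u + deg (res W) v) ^ 2.
have le_fg u' v' : f u' v' <= g u' v'.
  rewrite leq_mul2l; apply/orP; right.
  by have [+ _] := nat_AGM2 (deg (res W) u') (deg (res W) v'); lia.
have le_gf : \sum_u \sum_v g u v <= \sum_u \sum_v f u v.
  rewrite (_ : \sum_u \sum_v f u v =
    4 * (\sum_u \sum_v (res W u v * (deg (res W) u * deg (res W) v)))).
    by rewrite /g; lia.
  rewrite big_distrr; apply: eq_bigr => u' _; rewrite big_distrr.
  by apply: eq_bigr => v' _; rewrite /f mulnCA.
have le_fg' u' : \sum_v f u' v <= \sum_v g u' v by apply: leq_sum.
have eq_u := eq_of_leq_sum le_fg' le_gf u.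
have := eq_of_leq_sum (le_fg u) _ v; rewrite eq_u leqnn /f /g uv !mul1n => /(_ isT) eq4.
have [_] := nat_AGM2 (deg (res W) u) (deg (res W) v); rewrite -eq4 eqxx.
by move/esym/eqP.
Qed.

(* A path v-u-x-r with v, r not T-adjacent leaves r in [rest W u v], which is
   tight and so gives r a T-neighbour r' there; equality in the path count then
   forces u and r' to be T-adjacent, which is absurd. *)
Lemma tight_closed W v u x r :
  tight W -> res W v u -> res W u x -> res W x r -> res W v r.
Proof.
move=> tightW vu ux xr; apply/negPn/negP => nvr.
have [_ leGP] := tight_deg_paths tightW.
have uv : res W u v by rewrite res_sym.
have [/(_ u v uv)[tightR _] _] := tight_edge tightW.
have nur : ~~ res W u r by rewrite res_sym in ux; apply: res_free ux xr.
have rR : r \in rest W u v.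
  by rewrite !inE negb_or nur nvr; case/and3P: xr.
have [r' /and3P[_ r'R Trr']] := tight_no_isolated tightR rR.
move: r'R; rewrite !inE negb_or => /andP[/andP[nur' nvr'] r'W].
have rr' : res W r r' by rewrite /res r'W Trr'; case/and3P: xr => _ ->.
have := paths_gaps_eq (@res_sym W) (@res_free W) leGP vu ux xr rr' nvr nvr'.
by rewrite (negbTE nur').
Qed.

(** Let u be a [T]-neighbour of [x]. By closedness there are no path terms, and both ends have the
    same degree d, so L(xu) = 4d^2 and R(xu) = 4d^2 plus twice the number of non-adjacent pairs.
    That number is 0, but [x], [y] would be such a pair if u were not [T]-adjacent to [y]. *)
Lemma tight_joined W x y :
  tight W -> x \in W -> y \in W -> ~~ adj x y -> joined (res W) x y.
Proof.
move=> tightW xW yW nxy.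
have [u xu] := tight_no_isolated tightW xW.
have ux : res W u x by rewrite res_sym.
have [/(_ x u xu)[_ eq_rl] _] := tight_edge tightW.
have [eq_deg _] := tight_deg_paths tightW.
case uy: (res W u y); first exact: joinedP uy.
case xy: (res W x y); first by case/and3P: xy nxy => _ _ /T_adj->.
have yR : y \in rest W x u by rewrite !inE xy uy.
have xAB : x \in nbr W x :|: nbr W u by rewrite !inE ux orbT.
have := cnt_gt0 xAB yR (nxy : nadj x y).
have no_paths v w : res W v w -> paths (res W) v w = 0.
  move=> vw; rewrite /paths big1 // => a _; rewrite big1 // => b _.
  case va: (res W v a) => //; case ab: (res W a b) => //.
  by rewrite (@tight_closed W w v a b) // res_sym.
have sum_deg v : \sum_a (res W v a * deg (res W) a) = deg (res W) v * deg (res W) v.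
  rewrite [X in X * _]/deg big_distrl /=; apply: eq_bigr => a _.
  by case va: (res W v a) => //; rewrite (eq_deg v a).
move: eq_rl; rewrite /rhs /lhs !no_paths // !sum_deg (eq_deg x u) // -mulnn.
by nia.
Qed.

(* At least half of all ordered pairs lie on the same side of any cut. *)
Lemma tight_of_regular : (forall x, \sum_y (nadj x y : nat) = \sum_y (T x y : nat)) ->
  tight setT.
Proof.
move=> regT S.
(* A pair on the same side is uncut or non-adjacent, and regularity trades non-neighbours for
   [T]-neighbours. *)
have key x : \sum_(y : V) ((x \in S) == (y \in S)) <=
             \sum_y (uncut adj S x y : nat) + \sum_y (T x y : nat).
  rewrite -regT -big_split; apply: leq_sum => y _ /=; rewrite /uncut /nadj.
  by case: (adj x y); case: ((x \in S) == _).
rewrite !cnt_setT -mulnDr -big_split /=.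
apply: leq_trans (_ : 2 * \sum_(x : V) \sum_(y : V) ((x \in S) == (y \in S)) <= _).
  have same b : \sum_(y : V) (b == (y \in S)) = if b then #|S| else #|~: S|.
    rewrite -!sum1_card; case: b; rewrite big_mkcond /=;
      by rewrite [RHS]big_mkcond; apply: eq_bigr => y _; rewrite ?inE; case: (y \in S).
  under eq_bigr => x _ do rewrite same.
  rewrite (bigID (mem S)) /= (eq_bigr (fun=> #|S|)); last by move=> x ->.
  rewrite [X in _ + X](eq_bigr (fun=> #|~: S|)); last by move=> x /negbTE->.
  rewrite !sum_nat_const (eq_card (_ : [predC S] =i ~: S)); last by move=> x; rewrite !inE.
  rewrite cardsT -(cardsC S) -mulnn.
  by case: (nat_AGM2 #|S| #|~: S|); rewrite -mulnn; nia.
by rewrite leq_mul2l; apply: leq_sum.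
Qed.

End Tightness.

(** * Ordered pairs versus sets of edges *)

Section EdgeSets.
Variables (V : finType) (e : rel V).
Hypothesis e_sym : symmetric e.
Hypothesis e_irr : irreflexive e.

Definition edge_set : {set {set V}} :=
  [set [set p.1; p.2] | p : V * V & e p.1 p.2].

Lemma eq_edge a b x y : e a b ->
  ([set x; y] == [set a; b]) = ((x, y) == (a, b)) || ((x, y) == (b, a)).
Proof.
move=> eab; have nab : a != b by apply: contraTneq eab => ->; rewrite e_irr.
rewrite !xpair_eqE; apply/eqP/orP => [/setP eq_s|]; last first.
  by case=> /andP[/eqP-> /eqP->]; rewrite // setUC.
move: (eq_s a) (eq_s b) (eq_s x) (eq_s y); rewrite !inE !eqxx ?orbT.
rewrite (eq_sym b x) (eq_sym a x) (eq_sym b y) (eq_sym a y).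
case: (eqVneq x a) => [->|_]; rewrite ?(negbTE nab) /=; first by auto.
by case: (eqVneq x b) => _ /= -> //; auto.
Qed.

Lemma mem_edge_set x y : ([set x; y] \in edge_set) = e x y.
Proof.
apply/imsetP/idP => [[[a b]]|exy]; last by exists (x, y); rewrite ?inE.
rewrite inE /= => eab /eqP; rewrite eq_edge //.
by case/orP=> /eqP[-> ->]; rewrite // e_sym.
Qed.

(** Each edge is the image of exactly two ordered pairs. *)
Lemma card_edge_subset (F : {set {set V}}) : F \subset edge_set ->
  \sum_x \sum_y ([set x; y] \in F : nat) = 2 * #|F|.
Proof.
move=> /subsetP sub_F; rewrite pair_bigA /= -big_mkcondr /=.
rewrite (partition_big (fun p => [set p.1; p.2]) (mem F)) //=.
rewrite mulnC -sum_nat_const; apply: eq_bigr => s sF.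
have /imsetP[[a b]] := sub_F s sF; rewrite inE /= => eab def_s.
have nab : a != b by apply: contraTneq eab => ->; rewrite e_irr.
rewrite sum1_card -(_ : #|[set (a, b); (b, a)]| = 2); last first.
  by rewrite cards2 xpair_eqE negb_and nab.
apply: eq_card => -[x y]; rewrite !inE -(eq_edge x y eab) -def_s /=.
by apply: andb_idl => /eqP; rewrite /= => ->.
Qed.

Lemma card_edge_set : \sum_x \sum_y (e x y : nat) = 2 * #|edge_set|.
Proof.
rewrite -card_edge_subset //; apply: eq_bigr => x _; apply: eq_bigr => y _.
by rewrite mem_edge_set.
Qed.

End EdgeSets.

(** * Cuts versus bipartizing sets *)

Lemma edgesE (G : sgraph) : edges G = edge_set (@adj G).
Proof. by []. Qed.

Lemma uncut_irr (G : sgraph) (S : {set G}) : irreflexive (uncut (@adj G) S).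
Proof. by move=> x; rewrite /uncut adj_irr. Qed.

(** Deleting the uncut edges of [S] leaves a graph with bipartition [S]. *)
Lemma tauB_leq_uncut (G : sgraph) (S : {set G}) :
  2 * tauB G <= cnt (uncut (@adj G) S) setT setT.
Proof.
have u_sym := uncut_sym S (@adj_sym G).
rewrite cnt_setT card_edge_set // ?leq_mul2l /=; last exact: uncut_irr.
rewrite /tauB; case: arg_minnP => [|F _]; first exact: bipartizing_edges.
apply; apply/andP; split.
  apply/imsetS/subsetP => p; rewrite !inE => /andP[] //.
apply/existsP; exists S; apply/forallP => x; apply/forallP => y; apply/implyP.
case/andP=> /= xy; rewrite mem_edge_set //; last exact: uncut_irr.
by rewrite /uncut xy.
Qed.

(** Take for [S] a bipartition left by a minimum bipartizing set, which then contains every uncut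
    edge. *)
Lemma uncut_leq_tauB (G : sgraph) :
  exists S : {set G}, cnt (uncut (@adj G) S) setT setT <= 2 * tauB G.
Proof.
rewrite /tauB; case: arg_minnP => [|F]; first exact: bipartizing_edges.
case/andP=> subF /existsP[S /forallP cutS] _; exists S; rewrite cnt_setT.
rewrite -(card_edge_subset (@adj_irr G) subF).
apply: leq_sum => x _; apply: leq_sum => y _; rewrite /uncut.
have /forallP/(_ y) := cutS x; rewrite /= /delete_adj.
by case: (adj x y); case: (_ \in F); case: ((x \in S) == _).
Qed.

(** * Triangle-independent sets as relations *)

Section FromTriangleIndependent.
Variables (G : sgraph) (F : {set {set G}}).
Hypothesis F_ind : triangle_independent F.

Definition set_rel : rel G := fun x y => [set x; y] \in F.

Lemma set_rel_sym : symmetric set_rel.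
Proof. by move=> x y; rewrite /set_rel setUC. Qed.

Lemma set_rel_adj x y : set_rel x y -> adj x y.
Proof.
case/andP: F_ind => /subsetP subF _ /subF; rewrite edgesE mem_edge_set //.
  exact: adj_sym.
exact: adj_irr.
Qed.

Lemma set_rel_ind x y z : set_rel x y -> set_rel x z -> ~~ adj y z.
Proof.
move=> xy xz; apply/negP => yz.
case/andP: F_ind => _ /forallP/(_ y)/forallP/(_ x)/forallP/(_ z)/implyP.
have [Axy Axz] := (set_rel_adj xy, set_rel_adj xz).
rewrite /triangle adj_sym Axy Axz yz => /(_ isT); apply/negP; rewrite -ltnNge.
have nyz : y != z by apply: contraTneq yz => ->; rewrite adj_irr.
have neq : [set y; x] != [set x; z].
  rewrite setUC (eq_edge (@adj_irr G)) // !xpair_eqE negb_or !negb_and nyz orbT /=.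
  by apply/orP; left; apply: contraTneq Axz => ->; rewrite adj_irr.
apply: leq_trans (_ : #|[set [set y; x]; [set x; z]]| <= _); first by rewrite cards2 neq.
apply: subset_leq_card; apply/subsetP => s; rewrite !inE => /orP[]/eqP->.
  by rewrite -/(set_rel y x) set_rel_sym xy eqxx.
by rewrite -/(set_rel x z) xz eqxx !orbT.
Qed.

Lemma cnt_set_rel : cnt set_rel setT setT = 2 * #|F|.
Proof.
by rewrite cnt_setT; apply: (card_edge_subset (@adj_irr G)); case/andP: F_ind.
Qed.

End FromTriangleIndependent.

(** * The inequality and a criterion for equality *)

Lemma alpha1_attained (G : sgraph) :
  exists2 F : {set {set G}}, triangle_independent F & #|F| = alpha1 G.
Proof.
have ind0 : @triangle_independent G set0.
  rewrite /triangle_independent sub0set; do 3!apply/forallP => ?.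
  by rewrite set0I cards0 implybT.
have [|F Find eqF] := @eq_bigmax_cond _ (mem (@triangle_independent G)) (fun F => #|F|).
  by apply/card_gt0P; exists set0.
by exists F.
Qed.

Lemma alpha1_tauB_leq (G : sgraph) : 4 * (alpha1 G + tauB G) <= #|G| ^ 2.
Proof.
have [F Find <-] := alpha1_attained G.
have [S] := cut_bound (@adj_sym G) (@adj_irr G) (@set_rel_sym G F)
  (set_rel_adj Find) (set_rel_ind Find) setT.
rewrite cnt_set_rel // cardsT; have := tauB_leq_uncut S; lia.
Qed.

Lemma tight_of_eq (G : sgraph) (F : {set {set G}}) :
  triangle_independent F -> #|F| = alpha1 G -> 4 * (alpha1 G + tauB G) = #|G| ^ 2 ->
  tight (@adj G) (set_rel F) setT.
Proof.
move=> Find cardF eq4 S; rewrite cardsT -eq4 cnt_set_rel // cardF.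
have := tauB_leq_uncut S; lia.
Qed.

Lemma edge_set_ind (G : sgraph) (T : rel G) : symmetric T ->
  (forall x y, T x y -> adj x y) -> (forall x y z, T x y -> T x z -> ~~ adj y z) ->
  triangle_independent (edge_set T).
Proof.
move=> T_sym T_adj T_ind.
have T_irr : irreflexive T by move=> x; apply/negP => /T_adj; rewrite adj_irr.
apply/andP; split.
  by apply/imsetS/subsetP => p; rewrite !inE; apply: T_adj.
apply/forallP => x; apply/forallP => y; apply/forallP => z; apply/implyP.
case/and3P=> xy yz xz; rewrite leqNgt; apply/negP => /card_gt1P[s [s' []]].
rewrite !inE -!orbA => /andP[sT s3] /andP[s'T s'3] neq.
have n1 : T x y -> T y z -> False.
  by rewrite T_sym => h1 h2; have := T_ind _ _ _ h1 h2; rewrite xz.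
have n2 : T x y -> T x z -> False.
  by move=> h1 h2; have := T_ind _ _ _ h1 h2; rewrite yz.
have n3 : T y z -> T x z -> False.
  by rewrite (T_sym y) (T_sym x) => h1 h2; have := T_ind _ _ _ h1 h2; rewrite adj_sym xy.
move: sT s'T neq; case/or3P: s3 => /eqP->; case/or3P: s'3 => /eqP->;
  rewrite ?eqxx // !mem_edge_set // => h1 h2 _;
  by [case: (n1 h1 h2) | case: (n1 h2 h1) | case: (n2 h1 h2) | case: (n2 h2 h1)
     | case: (n3 h1 h2) | case: (n3 h2 h1)].
Qed.

(** Evaluating [tight_of_regular] at an optimal cut bounds |G|^2 by four times [tauB] plus the
    number of [T]-edges, and these form a triangle-independent set. *)
Lemma eq_of_regular (G : sgraph) (T : rel G) : symmetric T ->
  (forall x y, T x y -> adj x y) -> (forall x y z, T x y -> T x z -> ~~ adj y z) ->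
  (forall x, \sum_y (nadj (@adj G) x y : nat) = \sum_y (T x y : nat)) ->
  4 * (alpha1 G + tauB G) = #|G| ^ 2.
Proof.
move=> T_sym T_adj T_ind regT.
have T_irr : irreflexive T by move=> x; apply/negP => /T_adj; rewrite adj_irr.
apply/eqP; rewrite eqn_leq alpha1_tauB_leq /=.
have [S leS] := uncut_leq_tauB G.
have := tight_of_regular regT S; rewrite cardsT [cnt T _ _]cnt_setT.
rewrite (card_edge_set T_sym T_irr).
have : #|edge_set T| <= alpha1 G.
  by apply: (@leq_bigmax_cond {set {set G}}); apply: edge_set_ind.
rewrite mulnDr => leT /leq_trans; apply.
rewrite addnC mulnA; apply: leq_add; first by rewrite leq_mul2l.
by rewrite (_ : 4 = 2 * 2) // -[2 * 2 * tauB G]mulnA leq_mul2l.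
Qed.

(** * Recovering the join from the structure of [T] *)

Section JoinStructure.
Variables (G : sgraph) (T : rel G).
Implicit Types x y z : G.
Hypothesis T_sym : symmetric T.
Hypothesis T_adj : forall x y, T x y -> adj x y.
Hypothesis T_ind : forall x y z, T x y -> T x z -> ~~ adj y z.
Hypothesis T_total : forall x, exists y, T x y.
Hypothesis T_closed : forall v u x r, T v u -> T u x -> T x r -> T v r.
Hypothesis T_join : forall x y, ~~ adj x y -> exists2 z, T x z & T z y.
Hypothesis T_deg : forall x y, T x y -> #|[set z | T x z]| = #|[set z | T y z]|.

(** Non-adjacency and [T] compose like even and odd parity; this is the case odd plus odd. *)
Lemma T_T_nadj x y z : T x y -> T y z -> ~~ adj x z.
Proof. by rewrite T_sym; apply: T_ind. Qed.

(** A non-adjacent pair is replaced by a two-edge [T]-path, and [T_closed] contracts the resulting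
    three-edge path. *)
Lemma nadj_T x y z : ~~ adj x y -> T y z -> T x z.
Proof. by case/T_join=> w xw wy yz; apply: T_closed wy yz. Qed.

Lemma T_nadj x y z : T x y -> ~~ adj y z -> T x z.
Proof. by move=> xy; case/T_join=> w yw wz; apply: T_closed yw wz. Qed.

Lemma nadj_trans x y z : ~~ adj x y -> ~~ adj y z -> ~~ adj x z.
Proof.
move=> xy /T_join[w yw wz]; apply: T_T_nadj wz; exact: nadj_T yw.
Qed.

Lemma nadj_sym (x y : G) : ~~ adj x y -> ~~ adj y x.
Proof. by rewrite adj_sym. Qed.

(** The classes are the components of [T]. *)
Definition same_part x y := ~~ adj x y || T x y.

Lemma same_part_refl x : same_part x x.
Proof. by rewrite /same_part adj_irr. Qed.

Lemma same_part_sym x y : same_part x y = same_part y x.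
Proof. by rewrite /same_part adj_sym T_sym. Qed.

Lemma same_part_trans x y z : same_part x y -> same_part y z -> same_part x z.
Proof.
rewrite /same_part => /orP[xy|xy] /orP[yz|yz].
- by rewrite (nadj_trans xy yz).
- by rewrite (nadj_T xy yz) orbT.
- by rewrite (T_nadj xy yz) orbT.
- by rewrite (T_T_nadj xy yz).
Qed.

Definition part_repr x := odflt x [pick y | same_part x y].

Lemma part_reprP x : same_part x (part_repr x).
Proof.
by rewrite /part_repr; case: pickP => [//|/(_ x)]; rewrite same_part_refl.
Qed.

Lemma eq_part_repr x y : same_part x y -> part_repr x = part_repr y.
Proof.
move=> xy; rewrite /part_repr (@eq_pick _ _ (same_part y)) => [|z /=].
  by case: pickP => [//|/(_ y)]; rewrite same_part_refl.
apply/idP/idP; last exact: same_part_trans.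
by apply: same_part_trans; rewrite same_part_sym.
Qed.

Definition reprs := [set x | part_repr x == x].
Definition center (i : 'I_#|reprs|) : G := enum_val i.

Lemma center_inj i j : same_part (center i) (center j) -> i = j.
Proof.
move/eq_part_repr; have:= enum_valP i; have := enum_valP j.
by rewrite !inE -/(center i) -/(center j) => /eqP-> /eqP->; apply: enum_val_inj.
Qed.

Lemma center_ex x : exists i, same_part (center i) x.
Proof.
have rx : part_repr x \in reprs by rewrite inE -(eq_part_repr (part_reprP x)).
exists (enum_rank_in rx (part_repr x)).
by rewrite /center enum_rankK_in // same_part_sym part_reprP.
Qed.

(** The two colour classes of the part of [x]; [x] itself is on the side [false]. *)
Definition side (x : G) (b : bool) := [set y | if b then T x y else ~~ adj x y].

(** The non-neighbours of [x] are the [T]-neighbours of any [T]-neighbour of [x], so equal degrees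
    balance the two sides. *)
Lemma card_side x b : #|side x b| = #|[set y | T x y]|.
Proof.
case: b => //; have [y xy] := T_total x; rewrite (T_deg xy); apply: eq_card => z.
rewrite !inE; apply/idP/idP => [|yz]; last exact: T_T_nadj xy yz.
by apply: T_nadj; rewrite T_sym.
Qed.

Definition part_size i := #|[set y | T (center i) y]|.
Definition parts := join (fun i => Ktt (part_size i)).

Definition side_of t (v : Ktt t) : bool := if v is inl _ then false else true.
Definition index_of t (v : Ktt t) : 'I_t := match v with inl j => j | inr j => j end.

Definition vertex_of (u : parts) : G :=
  let x := center (tag u) in nth x (enum (side x (side_of (tagged u)))) (index_of (tagged u)).

Lemma vertex_of_side u : vertex_of u \in side (center (tag u)) (side_of (tagged u)).
Proof.
rewrite /vertex_of -mem_enum mem_nth // -cardE card_side.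
exact: ltn_ord.
Qed.

Lemma side_same_part x b y : y \in side x b -> same_part x y.
Proof. by rewrite inE /same_part; case: b => ->; rewrite ?orbT. Qed.

Lemma side_adj x b b' y y' : y \in side x b -> y' \in side x b' -> adj y y' = (b != b').
Proof.
rewrite !inE; case: b; case: b' => xy xy' /=.
- exact/negbTE/T_ind/xy'.
- by apply: T_adj; apply: T_nadj xy'; rewrite T_sym.
- by apply: T_adj; apply: nadj_T xy'; apply: nadj_sym.
- by apply/negbTE; apply: nadj_trans xy'; apply: nadj_sym.
Qed.

Lemma vertex_of_mono : {mono vertex_of : u v / adj u v}.
Proof.
move=> u v; have hu := vertex_of_side u; have hv := vertex_of_side v.
case: u v hu hv => [i u] [j v] /= hu hv.
rewrite [RHS]/= /join_adj /=; have [eq_ij|nij] := eqVneq i j; last first.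
  (* Non-adjacent vertices lie in the same part, so distinct parts are completely joined. *)
  apply/negPn/negP => nuv; case/eqP: nij; apply: center_inj.
  apply: same_part_trans (side_same_part hu) _.
  have := side_same_part hv; rewrite same_part_sym; apply: same_part_trans.
  by rewrite /same_part nuv.
case: j / eq_ij v hv => v hv; rewrite tagged_asE (side_adj hu hv) /=.
by case: (u); case: (v).
Qed.

Lemma vertex_of_inj : injective vertex_of.
Proof.
move=> u v eq_uv; have hu := vertex_of_side u; have hv := vertex_of_side v.
case: u v eq_uv hu hv => [i u] [j v] eq_uv /= hu hv.
have eq_ij : i = j.
  apply: center_inj; apply: same_part_trans (side_same_part hu) _.
  by rewrite eq_uv same_part_sym (side_same_part hv).
case: j / eq_ij v eq_uv hv => v eq_uv hv.
have eq_side : side_of u = side_of v.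
  by apply/eqP; rewrite -[_ == _]negbK -(side_adj hu hv) eq_uv adj_irr.
have lt_i (w : Ktt (part_size i)) b : index_of w < size (enum (side (center i) b)).
  by rewrite -cardE card_side ltn_ord.
move/eqP: eq_uv; rewrite /vertex_of /= eq_side nth_uniq ?enum_uniq ?lt_i //.
by case: u v eq_side {hu hv} => [a|a] [b|b] //= _ /eqP/val_inj->.
Qed.

Lemma vertex_of_surj x : exists u, vertex_of u == x.
Proof.
have [i ix] := center_ex x; pose b := T (center i) x.
have xb : x \in side (center i) b.
  by rewrite inE /b; case: ifP ix => // nT; rewrite /same_part nT orbF.
have lt_x : index x (enum (side (center i) b)) < part_size i.
  by rewrite /part_size -(card_side (center i) b) cardE index_mem mem_enum.
have [o def_o] : exists o : 'I_(part_size i), o = index x (enum (side (center i) b)) :> nat.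
  by exists (Ordinal lt_x).
exists (Tagged (fun i => Ktt (part_size i)) (if b then inr o else inl o : Ktt (part_size i))).
apply/eqP; rewrite /vertex_of /=.
have -> : side_of (if b then inr o else inl o) = b by case: (b).
have -> : index_of (if b then inr o else inl o) = o by case: (b).
by rewrite def_o nth_index // mem_enum.
Qed.

Lemma join_of_structure : join_of_balanced_bipartite G.
Proof.
exists #|reprs|, part_size; split=> [i|].
  have [y iy] := T_total (center i).
  by apply/card_gt0P; exists y; rewrite inE.
pose f x : parts := xchoose (vertex_of_surj x).
have fK : cancel f vertex_of by move=> x; apply/eqP/(xchooseP (vertex_of_surj x)).
have gK : cancel vertex_of f by apply: inj_can_sym vertex_of_inj.
exists f; first by exists vertex_of.
by move=> x y; rewrite -vertex_of_mono !fK.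
Qed.

End JoinStructure.

(** * The equality case *)

Lemma structure_of_eq (G : sgraph) :
  4 * (alpha1 G + tauB G) = #|G| ^ 2 -> join_of_balanced_bipartite G.
Proof.
move=> eq4; have [F Find cardF] := alpha1_attained G.
have tightF := tight_of_eq Find cardF eq4.
have A_sym := @adj_sym G; have A_irr := @adj_irr G.
have T_sym := @set_rel_sym G F; have T_adj := set_rel_adj Find.
have T_ind := set_rel_ind Find.
have resT x y : res (set_rel F) setT x y = set_rel F x y by rewrite /res !inE.
apply: (@join_of_structure G (set_rel F)) => //.
- move=> x; have [|y] := tight_no_isolated A_sym A_irr T_sym T_adj T_ind (x := x) tightF.
    by rewrite inE.
  by rewrite resT; exists y.
- move=> v u x r; rewrite -!resT; exact: tight_closed tightF.
- move=> x y nxy.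
  have /existsP[z] := tight_joined A_sym A_irr T_sym T_adj T_ind tightF
    (in_setT x) (in_setT y) nxy.
  by rewrite !resT => /andP[]; exists z.
- move=> x y; rewrite -resT => xy.
  have [eq_deg _] := tight_deg_paths A_sym A_irr T_sym T_adj T_ind tightF.
  have nbrE w : nbr (set_rel F) setT w = [set z | set_rel F w z].
    by apply/setP => z; rewrite !inE.
  by have := eq_deg _ _ xy; rewrite -!card_nbr !nbrE.
Qed.

Lemma eq_of_join (G : sgraph) :
  join_of_balanced_bipartite G -> 4 * (alpha1 G + tauB G) = #|G| ^ 2.
Proof.
case=> k [t [_ [f f_bij f_mono]]].
pose H := join (fun i => Ktt (t i)).
(* [TH] consists of all edges inside the bipartite parts. *)
pose TH : rel H := fun u v => (tag u == tag v) && adj u v.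
have TH_sym : symmetric TH by move=> u v; rewrite /TH adj_sym eq_sym.
(* Exchanging the sides of every part maps the non-neighbours of a vertex, itself included, onto its
   [TH]-neighbours; this gives the regularity required. *)
pose flip (u : H) : H := Tagged (fun i => Ktt (t i))
  (match tagged u : Ktt _ with inl j => inr j | inr j => inl j end : Ktt (t (tag u))).
have flipK : involutive flip by case=> i [j|j].
have flipP u v : ~~ adj u v = TH u (flip v).
  case: u v => [i u] [j v]; rewrite /TH /= /join_adj /=.
  have [eq_ij|nij] := eqVneq i j; last by [].
  by case: j / eq_ij v => v; rewrite !tagged_asE /=; case: u => u; case: v => v.
apply: (@eq_of_regular G (fun x y => TH (f x) (f y))).
- by move=> x y; apply: TH_sym.
- by move=> x y /andP[_]; rewrite f_mono.
- move=> x y z; rewrite -f_mono; case: (f x) (f y) (f z) => [i u] [j v] [l w].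
  rewrite /TH /= /join_adj /=.
  case/andP=> /eqP eq_ij; case: j / eq_ij v => v.
  rewrite eqxx tagged_asE /= => uv /andP[/eqP eq_il]; case: l / eq_il w => w.
  rewrite eqxx !tagged_asE /=.
  by case: u uv => u; case: v => v; case: w => w.
move=> x; case: f_bij => f' fK f'K.
have inj_flip : injective (fun y => f' (flip (f y))).
  by move=> y y' /(can_inj f'K)/(can_inj flipK)/(can_inj fK).
rewrite [RHS](reindex_inj inj_flip) /=; apply: eq_bigr => y _.
by rewrite f'K -flipP /nadj f_mono.
Qed.

Local Open Scope ring_scope.

Theorem theorem4 (G : sgraph) :
  ((alpha1 G + tauB G)%:R <= #|G|%:R ^+ 2 / 4%:R :> rat) /\
  ((alpha1 G + tauB G)%:R = #|G|%:R ^+ 2 / 4%:R :> rat <->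
   join_of_balanced_bipartite G).
Proof.
have gt0 : 0 < 4%:R :> rat by [].
split.
  by rewrite ler_pdivlMr // -natrX -natrM ler_nat mulnC alpha1_tauB_leq.
split=> [eqG|/eq_of_join eqG].
  apply: structure_of_eq; apply/eqP; rewrite -(eqr_nat rat) natrM eqG natrX.
  by rewrite mulrCA divff ?mulr1 // gt_eqF.
by apply: (canRL (mulfK (lt0r_neq0 gt0))); rewrite -natrX -natrM mulnC eqG.
Qed.
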